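(* Let $H$ be a Hopf algebra over a field $\Bbbk$. The following are equivalent: (i) $H$ is co-Frobenius. (ii) Every nonzero left $H$-comodule has a nonzero finite dimensional quotient comodule. (iii) Every nonzero injective left $H$-comodule has a nonzero finite dimensional quotient comodule. (iv) There is an injective left $H$-comodule which has a nonzero finite dimensional quotient comodule.
   Context: A left integral for $H$ is a linear map $\int:H\to\Bbbk$ with $\int(h_{(2)})h_{(1)}=\int(h)1_H$ for all $h\in H$. $H$ is called co-Frobenius if it has a nonzero left integral. *)

(* Defs.v *)
(* Hopf algebras and comodules over a field K, possibly
   infinite dimensional.  Tensor products V (x) W are represented by finite
   lists of pure tensors [:: (v1,w1); ...] (meaning sum v_i (x) w_i), and
   equality in V (x) W is the congruence generated by the defining relations
   of the tensor product (bi-additivity, balance of scalars, 0 (x) w = 0). *)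
From HB Require Import structures.
From mathcomp Require Import all_boot all_order all_algebra.
Set Implicit Arguments. Unset Strict Implicit. Unset Printing Implicit Defensive.
Import GRing.Theory.
Local Open Scope ring_scope.

Section Tensors.
Variable K : fieldType.

Inductive teq2 {V W : lmodType K} : seq (V * W) -> seq (V * W) -> Prop :=
| teq2_refl s : teq2 s s
| teq2_sym s t : teq2 s t -> teq2 t s
| teq2_trans s t u : teq2 s t -> teq2 t u -> teq2 s u
| teq2_cat s1 t1 s2 t2 : teq2 s1 t1 -> teq2 s2 t2 -> teq2 (s1 ++ s2) (t1 ++ t2)
| teq2_perm s t : perm_eq s t -> teq2 s t
| teq2_addl v v' w : teq2 [:: (v + v', w)] [:: (v, w); (v', w)]
| teq2_addr v w w' : teq2 [:: (v, w + w')] [:: (v, w); (v, w')]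
| teq2_scale (a : K) v w : teq2 [:: (a *: v, w)] [:: (v, a *: w)]
| teq2_zero w : teq2 [:: (0, w)] [::].

Inductive teq3 {U V W : lmodType K} :
    seq (U * V * W) -> seq (U * V * W) -> Prop :=
| teq3_refl s : teq3 s s
| teq3_sym s t : teq3 s t -> teq3 t s
| teq3_trans s t u : teq3 s t -> teq3 t u -> teq3 s u
| teq3_cat s1 t1 s2 t2 : teq3 s1 t1 -> teq3 s2 t2 -> teq3 (s1 ++ s2) (t1 ++ t2)
| teq3_perm s t : perm_eq s t -> teq3 s t
| teq3_add1 u u' v w : teq3 [:: (u + u', v, w)] [:: (u, v, w); (u', v, w)]
| teq3_add2 u v v' w : teq3 [:: (u, v + v', w)] [:: (u, v, w); (u, v', w)]
| teq3_add3 u v w w' : teq3 [:: (u, v, w + w')] [:: (u, v, w); (u, v, w')]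
| teq3_scale12 (a : K) u v w : teq3 [:: (a *: u, v, w)] [:: (u, a *: v, w)]
| teq3_scale23 (a : K) u v w : teq3 [:: (u, a *: v, w)] [:: (u, v, a *: w)]
| teq3_zero v w : teq3 [:: (0, v, w)] [::].

Definition tscale {V W : lmodType K} (a : K) (s : seq (V * W)) : seq (V * W) :=
  [seq (a *: p.1, p.2) | p <- s].

Definition klinear {V W : lmodType K} (f : V -> W) : Prop :=
  forall (a : K) x y, f (a *: x + y) = a *: f x + f y.

Definition kfunctional {V : lmodType K} (f : V -> K) : Prop :=
  forall (a : K) x y, f (a *: x + y) = a * f x + f y.

End Tensors.

Section Hopf.
Variable K : fieldType.
Variable H : algType K.

(* D = comultiplication (D h represents Delta(h) = sum h_(1) (x) h_(2)),
   e = counit, S = antipode *)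
Record is_hopf (D : H -> seq (H * H)) (e : H -> K) (S : H -> H) : Prop := {
  hopf_D_lin : forall (a : K) h g, teq2 (D (a *: h + g)) (tscale a (D h) ++ D g);
  hopf_e_lin : kfunctional e;
  hopf_S_lin : klinear S;
  hopf_coassoc : forall h,
    teq3 (flatten [seq [seq (q.1, q.2, p.2) | q <- D p.1] | p <- D h])
         (flatten [seq [seq (p.1, q.1, q.2) | q <- D p.2] | p <- D h]);
  hopf_counit_l : forall h, \sum_(p <- D h) e p.1 *: p.2 = h;
  hopf_counit_r : forall h, \sum_(p <- D h) e p.2 *: p.1 = h;
  hopf_D_mul : forall h g,
    teq2 (D (h * g)) [seq (p.1 * q.1, p.2 * q.2) | p <- D h, q <- D g];
  hopf_D_one : teq2 (D 1) [:: (1, 1)];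
  hopf_e_mul : forall h g, e (h * g) = e h * e g;
  hopf_e_one : e 1 = 1;
  hopf_antipode_l : forall h, \sum_(p <- D h) S p.1 * p.2 = (e h)%:A;
  hopf_antipode_r : forall h, \sum_(p <- D h) p.1 * S p.2 = (e h)%:A }.

Definition left_integral (D : H -> seq (H * H)) (I : H -> K) : Prop :=
  kfunctional I /\ forall h, \sum_(p <- D h) I p.2 *: p.1 = (I h)%:A.

Definition co_Frobenius (D : H -> seq (H * H)) : Prop :=
  exists I : H -> K, left_integral D I /\ exists h, I h != 0.

Variable D : H -> seq (H * H).
Variable e : H -> K.

Definition is_comodule (M : lmodType K) (rho : M -> seq (H * M)) : Prop :=
  [/\ forall (a : K) m n, teq2 (rho (a *: m + n)) (tscale a (rho m) ++ rho n),
      forall m,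
        teq3 (flatten [seq [seq (q.1, q.2, p.2) | q <- D p.1] | p <- rho m])
             (flatten [seq [seq (p.1, q.1, q.2) | q <- rho p.2] | p <- rho m])
    & forall m, \sum_(p <- rho m) e p.1 *: p.2 = m].

Record comodule := Comodule {
  cm_space : lmodType K;
  cm_coact : cm_space -> seq (H * cm_space);
  cm_ax : is_comodule cm_coact }.

Definition comod_mor (M N : comodule) (f : cm_space M -> cm_space N) : Prop :=
  klinear f /\
  forall m, teq2 (cm_coact (f m)) [seq (p.1, f p.2) | p <- cm_coact m].

Definition injective_comod (M : comodule) : Prop :=
  forall (A B : comodule) (i : cm_space A -> cm_space B)
         (f : cm_space A -> cm_space M),
    comod_mor i -> injective i -> comod_mor f ->
    exists g : cm_space B -> cm_space M,
      comod_mor g /\ forall x, g (i x) = f x.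

Definition nonzero_comod (M : comodule) : Prop :=
  exists m : cm_space M, m != 0.

Definition subcomodule (M : comodule) (N : cm_space M -> Prop) : Prop :=
  [/\ N 0, (forall (a : K) x y, N x -> N y -> N (a *: x + y))
    & forall n, N n -> exists t : seq (H * cm_space M),
         (forall p, p \in t -> N p.2) /\ teq2 (cm_coact n) t].

Definition has_nonzero_fd_quotient (M : comodule) : Prop :=
  exists N : cm_space M -> Prop,
    [/\ subcomodule N,
        (exists m, ~ N m)
      & exists ms : seq (cm_space M),
          forall m, exists c : seq K,
            N (m - \sum_(i < size ms) c`_i *: ms`_i)].

End Hopf.

(* Main.v *)
(* From (i) to (ii): given an integral [I], a functional [psi] on [M] and [y] in
   [H], the map [v |-> psi(v_(0)) I(y_(2) v_(-1)) y_(1)] is a comodule map from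
   [M] to [H] with coaction [y |-> S(y_(2)) (x) y_(1)], because
   [h_(1) I(y h_(2)) = S(y_(1)) I(y_(2) h)]. Its image is spanned by the
   finitely many [y_(1)], and it is nonzero for suitable [psi] and [y]: otherwise
   [I(h) m = I(h S(m_(-2)) m_(-1)) m_(0) = 0] for all [h] and [m].
   From (iii) to (iv): [H] is an injective comodule over itself.
   From (iv) to (i): an injective [M] is a retract of the cofree comodule
   [H (x) M], so a finite dimensional quotient [Q] of [M] receives a nonzero
   comodule map [f = (f_j)] from [H]. If [C] is the coefficient matrix of [Q],
   then [h |-> \sum_j f_j (h S^2(C j l))] is an integral for every [l], and
   these integrals determine [f]. *)
From HB Require Import structures.
Require Import Defs.
From mathcomp Require Import all_boot all_order all_algebra.
From mathcomp Require Import boolp classical_sets.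

Set Implicit Arguments. Unset Strict Implicit. Unset Printing Implicit Defensive.
Import GRing.Theory.
Local Open Scope ring_scope.

(** * Linear maps and functionals *)

Section LinearMaps.
Variable K : fieldType.
Implicit Types U V W X : lmodType K.

Lemma kfunctional_klinear V (f : V -> K) :
  kfunctional f -> klinear (f : V -> K^o).
Proof. by []. Qed.

Section Klinear.
Variables (V W : lmodType K) (f : V -> W).
Hypothesis fL : klinear f.

Lemma klin0 : f 0 = 0.
Proof.
have := fL 1 0 0; rewrite !scale1r addr0 => /eqP.
by rewrite -subr_eq0 opprD addrA subrr sub0r oppr_eq0 => /eqP.
Qed.

Lemma klinD x y : f (x + y) = f x + f y.
Proof. by rewrite -[x in LHS]scale1r fL scale1r. Qed.

Lemma klinZ a x : f (a *: x) = a *: f x.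
Proof. by rewrite -[a *: x]addr0 fL klin0 addr0. Qed.

Lemma klinB x y : f (x - y) = f x - f y.
Proof. by rewrite -scaleN1r klinD klinZ scaleN1r. Qed.

Lemma klin_bigsum I (r : seq I) (F : I -> V) :
  f (\sum_(i <- r) F i) = \sum_(i <- r) f (F i).
Proof.
elim: r => [|i r IH]; first by rewrite !big_nil klin0.
by rewrite !big_cons klinD IH.
Qed.

End Klinear.

Lemma kfunZ V (f : V -> K) a x : kfunctional f -> f (a *: x) = a * f x.
Proof. by move=> fL; apply: (klinZ (kfunctional_klinear fL)). Qed.

Lemma kfun_bigsum V (f : V -> K) I (r : seq I) (F : I -> V) :
  kfunctional f -> f (\sum_(i <- r) F i) = \sum_(i <- r) f (F i).
Proof. by move=> fL; apply: (klin_bigsum (kfunctional_klinear fL)). Qed.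

Lemma klinear_id V : klinear (fun x : V => x).
Proof. by []. Qed.

Lemma klinear_comp U V W (f : V -> W) (g : U -> V) :
  klinear f -> klinear g -> klinear (fun x => f (g x)).
Proof. by move=> fL gL a x y; rewrite gL fL. Qed.

Lemma klinear_sum V W I (r : seq I) (F : I -> V -> W) :
  (forall i, klinear (F i)) -> klinear (fun x => \sum_(i <- r) F i x).
Proof.
move=> FL a x y; rewrite scaler_sumr -big_split /=.
by apply: eq_bigr => i _; rewrite FL.
Qed.

Lemma klinear_scalel V W (f : V -> K) (w : W) :
  kfunctional f -> klinear (fun x => f x *: w).
Proof. by move=> fL a x y; rewrite fL scalerDl scalerA. Qed.

Lemma klinear_scaler V W (f : V -> W) (c : K) :
  klinear f -> klinear (fun x => c *: f x).
Proof. by move=> fL a x y; rewrite fL scalerDr !scalerA mulrC. Qed.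

Lemma klinear_sub V W (f g : V -> W) :
  klinear f -> klinear g -> klinear (fun x => f x - g x).
Proof.
by move=> fL gL a x y; rewrite fL gL scalerBr opprD addrACA.
Qed.

Lemma klinear_mull V (A : algType K) (f : V -> A) (c : A) :
  klinear f -> klinear (fun x => c * f x).
Proof. by move=> fL a x y; rewrite fL mulrDr scalerAr. Qed.

Lemma klinear_mulr V (A : algType K) (f : V -> A) (c : A) :
  klinear f -> klinear (fun x => f x * c).
Proof. by move=> fL a x y; rewrite fL mulrDl scalerAl. Qed.

Lemma kfunctional_comp V W (f : W -> K) (g : V -> W) :
  kfunctional f -> klinear g -> kfunctional (fun x => f (g x)).
Proof. by move=> fL gL a x y; rewrite gL fL. Qed.

Lemma kfunctional_bigsum V I (r : seq I) (F : I -> V -> K) :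
  (forall i, kfunctional (F i)) -> kfunctional (fun x => \sum_(i <- r) F i x).
Proof. by move=> FL; apply: (@klinear_sum V K^o). Qed.

Lemma kfunctional_mull V (f : V -> K) (c : K) :
  kfunctional f -> kfunctional (fun x => c * f x).
Proof. by move=> fL; apply: (@klinear_scaler V K^o). Qed.

Lemma kfunctional_mulr V (f : V -> K) (c : K) :
  kfunctional f -> kfunctional (fun x => f x * c).
Proof. by move=> fL; apply: (@klinear_scalel V K^o). Qed.

End LinearMaps.

(** * Separation by linear functionals and subspaces of finite codimension *)

Section Functionals.
Variable K : fieldType.
Implicit Types V W : lmodType K.

Definition subspace V (P : V -> Prop) :=
  P 0 /\ forall (a : K) x y, P x -> P y -> P (a *: x + y).

Section Subspace.
Variables (V : lmodType K) (P : V -> Prop).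
Hypothesis PS : subspace P.

Lemma subspaceD x y : P x -> P y -> P (x + y).
Proof. by move=> Px Py; rewrite -[x]scale1r; apply: PS.2. Qed.

Lemma subspaceZ a x : P x -> P (a *: x).
Proof. by move=> Px; rewrite -[_ *: _]addr0; apply: PS.2 => //; apply: PS.1. Qed.

Lemma subspaceB x y : P x -> P y -> P (x - y).
Proof.
by move=> Px Py; apply: subspaceD => //; rewrite -scaleN1r; apply: subspaceZ.
Qed.

Lemma subspace_sum I (r : seq I) (F : I -> V) :
  (forall i, P (F i)) -> P (\sum_(i <- r) F i).
Proof.
move=> PF; elim: r => [|i r IH]; first by rewrite big_nil; apply: PS.1.
by rewrite big_cons; apply: subspaceD.
Qed.

End Subspace.

(* By Zorn, a subspace maximal among those avoiding [u] is a hyperplane. *)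
Lemma maximal_subspace V (P : V -> Prop) (u : V) :
  subspace P -> ~ P u ->
  exists Q : V -> Prop, [/\ subspace Q, forall x, P x -> Q x, ~ Q u
    & forall x, exists a, Q (x - a *: u)].
Proof.
move=> PS Pu.
pose good (Q : set V) :=
  [/\ forall (a : K) x y, Q x -> Q y -> Q (a *: x + y), ~ Q u
    & (exists x, Q x) -> forall x, P x -> Q x].
have [F Fgood Ftot|Q [[QC Qu QP] Qmax]] := @Zorn_bigcup V good.
  split.
  - move=> a x y [A FA Ax] [B FB By].
    have [AB|BA] := Ftot _ _ FA FB.
      by exists B => //; have [BL _ _] := Fgood _ FB; apply: BL => //; apply: AB.
    by exists A => //; have [AL _ _] := Fgood _ FA; apply: AL => //; apply: BA.
  - by move=> [A FA Au]; have [_ /(_ Au)] := Fgood _ FA.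
  - move=> [x [A FA Ax]] y Py; exists A => //.
    by have [_ _ AP] := Fgood _ FA; apply: AP => //; exists x.
have Qne : exists x, Q x.
  apply: contrapT => Q0; apply: (Qmax P).
    by split=> [x Qx|PQ]; [case: Q0; exists x|apply: Q0; exists 0; apply/PQ/PS.1].
  by split=> //; apply: PS.2.
have PQ := QP Qne; have Q0 : Q 0 by apply/PQ/PS.1.
have QS : subspace Q by [].
exists Q; split=> // x.
have [Qx|Qx] := pselect (Q x); first by exists 0; rewrite scale0r subr0.
(* [Q'] is spanned by [Q] and [x]. As [x] lies outside [Q], maximality forces [u] into [Q'], and the
   resulting relation is solved for [x]. *)
pose Q' : set V := fun y => exists b, Q (y - b *: x).
have Q'C (a : K) y z : Q' y -> Q' z -> Q' (a *: y + z).
  move=> [b Qb] [c Qc]; exists (a * b + c).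
  by rewrite scalerDl opprD addrACA -scalerA -scalerBr; apply: QC.
have QQ' y : Q y -> Q' y by move=> Qy; exists 0; rewrite scale0r subr0.
have [b Qb] : Q' u.
  apply: contrapT => Q'u; apply: (Qmax Q').
    split=> [y /QQ'//|Q'Q]; apply/Qx/Q'Q; exists 1.
    by rewrite scale1r subrr.
  by split=> // _ y Py; apply/QQ'/PQ.
have b0 : b != 0.
  by apply/eqP => b0; apply: Qu; rewrite b0 scale0r subr0 in Qb.
exists b^-1; rewrite -[_ - _]opprK opprB -scaleN1r; apply: (subspaceZ QS).
have := subspaceZ QS b^-1 Qb.
by rewrite scalerBr scalerA mulVf // scale1r.
Qed.

(** The functional is the [u]-coordinate with respect to a hyperplane [Q] that contains [P] and
    avoids [u]; it is well defined because [u] is not in [Q]. *)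
Lemma separating_functional V (P : V -> Prop) (u : V) :
  subspace P -> ~ P u ->
  exists f : V -> K, [/\ kfunctional f, forall x, P x -> f x = 0 & f u = 1].
Proof.
move=> PS Pu; have [Q [QS PQ Qu Qhyp]] := maximal_subspace PS Pu.
have [f fP] := choice Qhyp.
have fU x a : Q (x - a *: u) -> f x = a.
  move=> Qx; apply/eqP; rewrite -subr_eq0; apply/eqP; apply: contrapT => /eqP ne.
  apply: Qu; rewrite -[u]scale1r -(mulVf ne) -scalerA.
  apply: (subspaceZ QS); rewrite scalerBl.
  have := subspaceB QS Qx (fP x).
  by rewrite opprB addrC addrA subrK.
exists f; split.
- move=> a x y; apply: fU; rewrite scalerDl opprD addrACA -scalerA -scalerBr.
  by apply: QS.2.
- by move=> x Px; apply: fU; rewrite scale0r subr0; apply: PQ.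
- by apply: fU; rewrite scale1r subrr; apply: QS.1.
Qed.

Lemma zero_subspace V : subspace (fun x : V => x = 0).
Proof. by split=> // a x y -> ->; rewrite scaler0 addr0. Qed.

Lemma nonzero_functional V (u : V) : u != 0 ->
  exists f : V -> K, kfunctional f /\ f u = 1.
Proof.
move=> /eqP u0; have [f [fL _ fu]] := separating_functional (zero_subspace V) u0.
by exists f.
Qed.

(* The extension is read off a functional on [B * K] that kills the graph of
   [f] and maps [(0, 1)] to [1]. *)
Lemma extend_functional (A B : lmodType K) (i : A -> B) (f : A -> K) :
  klinear i -> injective i -> kfunctional f ->
  exists g : B -> K, kfunctional g /\ forall x, g (i x) = f x.
Proof.
move=> iL iI fL.
pose P (z : (B * K^o)%type) := exists x, z = (i x, f x).
have f0 : f 0 = 0 := klin0 (kfunctional_klinear fL).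
have PS : subspace P.
  split=> [|a _ _ [x ->] [y ->]]; first by exists 0; rewrite (klin0 iL) f0.
  by exists (a *: x + y); rewrite iL fL.
have Pu : ~ P (0, 1).
  case=> x [/esym]; rewrite -(klin0 iL) => /iI -> /eqP.
  by rewrite f0 oner_eq0.
have [F [FL FP Fu]] := separating_functional PS Pu.
exists (fun b => - F (b, 0)); split=> [a x y|x].
  rewrite mulrN -opprD -FL; congr (- F _).
  by congr pair; rewrite /= scaler0 addr0.
have /FP : P (i x, f x) by exists x.
have -> : (i x, f x) = f x *: (0, 1) + (i x, 0) :> (B * K^o)%type.
  by congr pair; rewrite /= ?scaler0 ?add0r // addr0 [RHS]mulr1.
by rewrite FL Fu mulr1 => /eqP; rewrite addr_eq0 => /eqP ->.
Qed.

(** Induction on [ms]: the earlier coordinates are subtracted from the new vector, and the remainder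
    joins the family only when it lies outside [N]. *)
Lemma dual_basis_mod V (N : V -> Prop) (ms : seq V) : subspace N ->
  exists (n : nat) (x : 'I_n -> V) (f : 'I_n -> V -> K),
    [/\ forall i, kfunctional (f i), forall i v, N v -> f i v = 0,
        forall i j, f i (x j) = (i == j)%:R
      & forall v, v \in ms -> N (v - \sum_i f i v *: x i)].
Proof.
move=> NS; elim: ms => [|u ms [n [x [f [fL fN fx fms]]]]].
  by exists 0%N, (fun _ => 0), (fun _ _ => 0); split=> // [[]//|[]//].
pose u' := u - \sum_i f i u *: x i.
have [Nu|Nu] := pselect (N u').
  exists n, x, f; split=> // v; rewrite inE => /orP[/eqP -> //|]; exact: fms.
(* [N'] is the sum of [N] and the span of the [x i], so a functional separating [u'] from it kills
   both. *)
pose N' v := N (v - \sum_i f i v *: x i).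
have pL : klinear (fun v => v - \sum_i f i v *: x i).
  by apply: klinear_sub => //; apply: klinear_sum => i; apply: klinear_scalel.
have fsum i v : f i (\sum_j f j v *: x j) = f i v.
  rewrite (klin_bigsum (kfunctional_klinear (fL i))).
  under eq_bigr => j _ do rewrite (klinZ (kfunctional_klinear (fL i))) fx.
  rewrite (bigD1 i) //= eqxx [_ *: _]mulr1 big1 ?addr0 // => j ji.
  by rewrite eq_sym (negPf ji) scaler0.
have fu' i : f i u' = 0.
  by rewrite (klinB (kfunctional_klinear (fL i))) fsum subrr.
have N'S : subspace N'.
  split=> [|a v w Nv Nw]; rewrite /N'.
    by rewrite (klin0 pL); apply: NS.1.
  by rewrite pL; apply: NS.2.
have N'u : ~ N' u'.
  rewrite /N' big1 ?subr0 // => i _; by rewrite fu' scale0r.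
have [g [gL gN gu]] := separating_functional N'S N'u.
have gx i : g (x i) = 0.
  apply: gN; rewrite /N' (bigD1 i) //= fx eqxx scale1r big1 ?addr0 ?subrr.
    exact: NS.1.
  by move=> j ji; rewrite fx (negPf ji) scale0r.
have gkL := kfunctional_klinear gL.
have gu1 : g u = 1.
  rewrite -[u](subrK (\sum_i f i u *: x i)) -/u' (klinD gkL) gu (klin_bigsum gkL).
  by rewrite big1 ?addr0 // => i _; rewrite (klinZ gkL) gx scaler0.
exists n.+1, (fun i => if unlift ord_max i is Some j then x j else u'),
   (fun i => if unlift ord_max i is Some j then f j else g).
split.
- by move=> i; case: unliftP.
- move=> i v Nv; case: unliftP => [j|] _; first exact: fN.
  apply: gN; rewrite /N' big1 ?subr0 // => k _; by rewrite fN // scale0r.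
- move=> i j; case: unliftP => [i' ->|->]; case: unliftP => [j' ->|->] //.
  + by rewrite fx (inj_eq lift_inj).
  + by rewrite fu' eq_sym (negPf (neq_lift _ _)).
  + by rewrite gx (negPf (neq_lift _ _)).
  + by rewrite gu eqxx.
- move=> v; rewrite big_ord_recr /= unlift_none.
  have liftE (i : 'I_n) : widen_ord (leqnSn n) i = lift ord_max i.
    by apply: val_inj; rewrite /= /bump leqNgt ltn_ord.
  rewrite (eq_bigr (fun i => f i v *: x i)) => [|i _]; last first.
    by rewrite liftE liftK.
  rewrite inE => /orP[/eqP ->|vms].
    by rewrite gu1 scale1r opprD addrA subrr; apply: NS.1.
  by rewrite gN ?scale0r ?addr0; apply: fms.
Qed.

(** Each functional costs at most one dimension. If the head [t] is nonzero at some [u] killed by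
    the tail, then subtracting [(t w / t u) *: u] corrects [w] without disturbing the tail. The
    default of [nth] is the zero functional, so the statement can range over all indices. *)
Lemma common_kernel_cofinite V (thetas : seq (V -> K)) :
  (forall i, kfunctional (nth (fun _ => 0) thetas i)) ->
  exists ms : seq V, forall v, exists c : seq K,
    forall i, nth (fun _ => 0) thetas i (v - \sum_(j < size ms) c`_j *: ms`_j) = 0.
Proof.
elim: thetas => [|t ts IH] tL.
  by exists [::] => v; exists [::] => i; rewrite nth_nil.
have [ms msP] := IH (fun i => tL i.+1).
have tL0 : kfunctional t := tL 0%N.
have [[u [tu tsu]]|no] := pselect (exists u, t u <> 0 /\
    forall i, nth (fun _ => 0) ts i u = 0); last first.
  exists ms => v; have [c cP] := msP v; exists c => -[|i] /=; last exact: cP.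
  by apply: contrapT => tv; apply: no; eexists; split; [exact: tv|exact: cP].
exists (u :: ms) => v; have [c cP] := msP v.
set w := v - _ in cP; exists (t w / t u :: c) => i.
rewrite big_ord_recl /=.
have -> : v - (t w / t u *: u + \sum_(j < size ms) c`_j *: ms`_j)
     = w - (t w / t u) *: u by rewrite opprD addrA addrAC.
case: i => [|i] /=.
  rewrite (klinB (kfunctional_klinear tL0)) (klinZ (kfunctional_klinear tL0)).
  by rewrite [_ *: _]mulfVK ?subrr //; apply/eqP.
have tLi : klinear (nth (fun _ => 0) ts i : V -> K^o) := tL i.+1.
by rewrite (klinB tLi) (klinZ tLi) cP tsu scaler0 subr0.
Qed.

End Functionals.

(** * Tensors *)

Section Multilinear.
Variable K : fieldType.
Implicit Types U V W X Y : lmodType K.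

Definition bilin V W X (b : V -> W -> X) :=
  (forall w, klinear (b^~ w)) /\ (forall v, klinear (b v)).

Definition trilin U V W X (b : U -> V -> W -> X) :=
  [/\ forall v w, klinear (fun u => b u v w),
      forall u w, klinear (fun v => b u v w)
    & forall u v, klinear (b u v)].

(** A bilinear map respects every generating relation. Equalities of tensors are mostly exploited
    through such evaluations. *)
Lemma teq2_sum V W X (b : V -> W -> X) s t : bilin b -> teq2 s t ->
  \sum_(p <- s) b p.1 p.2 = \sum_(p <- t) b p.1 p.2.
Proof.
move=> [bL1 bL2]; elim=> {s t}.
- by [].
- by move=> s t _ ->.
- by move=> s t u _ -> _ ->.
- by move=> s1 t1 s2 t2 _ IH1 _ IH2; rewrite !big_cat IH1 IH2.
- by move=> s t st; apply: perm_big.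
- by move=> v v' w; rewrite !big_cons !big_nil !addr0 (klinD (bL1 w)).
- by move=> v w w'; rewrite !big_cons !big_nil !addr0 (klinD (bL2 v)).
- move=> a v w; rewrite !big_seq1 /=.
  by rewrite (klinZ (bL2 v)) (klinZ (bL1 w)).
- by move=> w; rewrite big_seq1 big_nil (klin0 (bL1 w)).
Qed.

Lemma teq3_sum U V W X (b : U -> V -> W -> X) s t : trilin b -> teq3 s t ->
  \sum_(p <- s) b p.1.1 p.1.2 p.2 = \sum_(p <- t) b p.1.1 p.1.2 p.2.
Proof.
move=> [bL1 bL2 bL3]; elim=> {s t}.
- by [].
- by move=> s t _ ->.
- by move=> s t u _ -> _ ->.
- by move=> s1 t1 s2 t2 _ IH1 _ IH2; rewrite !big_cat IH1 IH2.
- by move=> s t st; apply: perm_big.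
- by move=> u u' v w; rewrite !big_cons !big_nil !addr0 (klinD (bL1 v w)).
- by move=> u v v' w; rewrite !big_cons !big_nil !addr0 (klinD (bL2 u w)).
- by move=> u v w w'; rewrite !big_cons !big_nil !addr0 (klinD (bL3 u v)).
- by move=> a u v w; rewrite !big_seq1 /= (klinZ (bL1 v w)) (klinZ (bL2 u w)).
- by move=> a u v w; rewrite !big_seq1 /= (klinZ (bL2 u w)) (klinZ (bL3 u v)).
- by move=> v w; rewrite big_seq1 big_nil (klin0 (bL1 v w)).
Qed.

Lemma teq2_linear_sum U V W X (rho : U -> seq (V * W)) (b : V -> W -> X) :
  (forall a x y, teq2 (rho (a *: x + y)) (tscale a (rho x) ++ rho y)) ->
  bilin b -> klinear (fun x => \sum_(p <- rho x) b p.1 p.2).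
Proof.
move=> rhoL bB a x y; rewrite (teq2_sum bB (rhoL a x y)) big_cat big_map.
rewrite scaler_sumr; congr (_ + _).
by apply: eq_bigr => p _; rewrite (klinZ (bB.1 _)).
Qed.

Lemma bilin_comp U V W X Y (b : V -> W -> X) (f : U -> V) (g : Y -> W) :
  bilin b -> klinear f -> klinear g -> bilin (fun x y => b (f x) (g y)).
Proof.
move=> [bL1 bL2] fL gL; split=> [y|x].
  by move=> a x x'; rewrite fL bL1.
by move=> a y y'; rewrite gL bL2.
Qed.

End Multilinear.

Section TensorLists.
Variable K : fieldType.
Implicit Types U V W : lmodType K.

Lemma teq2_catC V W (s t : seq (V * W)) : teq2 (s ++ t) (t ++ s).
Proof. by apply: teq2_perm; rewrite perm_catC. Qed.

Lemma teq2_tscale V W (a : K) (s t : seq (V * W)) :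
  teq2 s t -> teq2 (tscale a s) (tscale a t).
Proof.
elim=> {s t}.
- by move=> s; apply: teq2_refl.
- by move=> s t _; apply: teq2_sym.
- by move=> s t u _ IH1 _; apply: teq2_trans.
- by move=> s1 t1 s2 t2 _ IH1 _ IH2; rewrite /tscale !map_cat; apply: teq2_cat.
- by move=> s t st; apply/teq2_perm/perm_map.
- by move=> v v' w; rewrite /= scalerDr; apply: teq2_addl.
- by move=> v w w'; apply: teq2_addr.
- move=> b v w; rewrite /= scalerA mulrC -scalerA; exact: teq2_scale.
- by move=> w; rewrite /= scaler0; apply: teq2_zero.
Qed.

Lemma tscaleDl V W (a b : K) (s : seq (V * W)) :
  teq2 (tscale (a + b) s) (tscale a s ++ tscale b s).
Proof.
elim: s => [|[v w] s IH]; first exact: teq2_refl.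
rewrite /= -cat1s -[_ :: tscale a s ++ _]cat1s scalerDl.
apply: teq2_trans (teq2_cat (teq2_addl _ _ _) IH) _.
by apply: teq2_perm; rewrite /= perm_cons perm_sym (perm_catCA _ [:: _]).
Qed.

Lemma tscale0 V W (s : seq (V * W)) : teq2 (tscale 0 s) [::].
Proof.
elim: s => [|[v w] s IH]; first exact: teq2_refl.
by rewrite /= scale0r; exact: (teq2_cat (teq2_zero w) IH).
Qed.

Lemma tscale1 V W (s : seq (V * W)) : tscale 1 s = s.
Proof.
by rewrite /tscale -[RHS]map_id; apply: eq_map => -[v w] /=; rewrite scale1r.
Qed.

Lemma tscaleA V W (a b : K) (s : seq (V * W)) :
  tscale a (tscale b s) = tscale (a * b) s.
Proof. by rewrite /tscale -map_comp; apply: eq_map => p /=; rewrite scalerA. Qed.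

Lemma teq3_map3 U V W W' (f : W -> W') s t : klinear f -> teq3 s t ->
  teq3 [seq (p.1.1 : U, p.1.2 : V, f p.2) | p <- s]
       [seq (p.1.1, p.1.2, f p.2) | p <- t].
Proof.
move=> fL; elim=> {s t}.
- by move=> s; apply: teq3_refl.
- by move=> s t _; apply: teq3_sym.
- by move=> s t u _ IH1 _; apply: teq3_trans.
- by move=> s1 t1 s2 t2 _ IH1 _ IH2; rewrite !map_cat; apply: teq3_cat.
- by move=> s t st; apply/teq3_perm/perm_map.
- by move=> u u' v w; apply: teq3_add1.
- by move=> u v v' w; apply: teq3_add2.
- by move=> u v w w' /=; rewrite (klinD fL); apply: teq3_add3.
- by move=> a u v w; apply: teq3_scale12.
- by move=> a u v w /=; rewrite (klinZ fL); apply: teq3_scale23.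
- by move=> v w; apply: teq3_zero.
Qed.

Lemma teq2_teq3 U V W (u : U) (s t : seq (V * W)) : teq2 s t ->
  teq3 [seq (u, p.1, p.2) | p <- s] [seq (u, p.1, p.2) | p <- t].
Proof.
elim=> {s t}.
- by move=> s; apply: teq3_refl.
- by move=> s t _; apply: teq3_sym.
- by move=> s t w _ IH1 _; apply: teq3_trans.
- by move=> s1 t1 s2 t2 _ IH1 _ IH2; rewrite !map_cat; apply: teq3_cat.
- by move=> s t st; apply/teq3_perm/perm_map.
- by move=> v v' w; apply: teq3_add2.
- by move=> v w w'; apply: teq3_add3.
- by move=> a v w; apply: teq3_scale23.
(* [teq3_zero] kills a zero in the first slot only, so the scalar [0] is moved there from the second
   slot. *)
- move=> w /=; rewrite -[X in (_, X, _)](scale0r (0 : V)).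
  apply: teq3_trans (teq3_sym (teq3_scale12 _ _ _ _)) _.
  by rewrite scale0r; apply: teq3_zero.
Qed.

Lemma teq3_pointwise U V W I (F G : I -> seq (U * V * W)) (r : seq I) :
  (forall i, teq3 (F i) (G i)) ->
  teq3 (flatten [seq F i | i <- r]) (flatten [seq G i | i <- r]).
Proof.
by move=> FG; elim: r => [|i r IH]; [apply: teq3_refl|apply: teq3_cat].
Qed.

End TensorLists.

(** * The tensor product as a quotient vector space *)

Section TensorSpace.
Variables (K : fieldType) (V W : lmodType K).
Local Open Scope quotient_scope.

(** Quotient types are built from boolean relations; classical logic supplies one. *)
Definition teq2b (s t : seq (V * W)) : bool := `[< teq2 s t >].

Lemma teq2b_refl : reflexive teq2b.
Proof. by move=> s; apply/asboolP; apply: teq2_refl. Qed.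

Lemma teq2b_sym : symmetric teq2b.
Proof. by move=> s t; apply/asboolP/asboolP => h; apply: teq2_sym. Qed.

Lemma teq2b_trans : transitive teq2b.
Proof.
by move=> t s u /asboolP h /asboolP h'; apply/asboolP; apply: teq2_trans h h'.
Qed.

Canonical teq2_equiv := EquivRel teq2b teq2b_refl teq2b_sym teq2b_trans.

Definition tensor := {eq_quot teq2_equiv}.
HB.instance Definition _ := Choice.on tensor.

Definition tclass (s : seq (V * W)) : tensor := \pi_{eq_quot teq2_equiv} s.
Definition tlist (x : tensor) : seq (V * W) := repr x.

Lemma tclassP s t : tclass s = tclass t <-> teq2 s t.
Proof. by split=> [/eqmodP/asboolP|h] //; apply/eqmodP/asboolP. Qed.

Lemma tlistK x : tclass (tlist x) = x.
Proof. exact: reprK. Qed.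

Lemma tclassK s : teq2 (tlist (tclass s)) s.
Proof. by apply/tclassP; rewrite tlistK. Qed.

Definition tadd (x y : tensor) := tclass (tlist x ++ tlist y).
Definition tmulr (a : K) (x : tensor) := tclass (tscale a (tlist x)).

Lemma tclass_cat s t : tclass (s ++ t) = tadd (tclass s) (tclass t).
Proof. by apply/tclassP/teq2_cat; apply/teq2_sym/tclassK. Qed.

Lemma tclass_scale a s : tclass (tscale a s) = tmulr a (tclass s).
Proof. by apply/tclassP/teq2_tscale/teq2_sym/tclassK. Qed.

Fact taddA : associative tadd.
Proof.
move=> x y z; rewrite -[x]tlistK -[y]tlistK -[z]tlistK.
by rewrite -!tclass_cat catA.
Qed.

Fact taddC : commutative tadd.
Proof.
move=> x y; rewrite -[x]tlistK -[y]tlistK -!tclass_cat.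
by apply/tclassP/teq2_catC.
Qed.

Fact tadd0 : left_id (tclass [::]) tadd.
Proof. by move=> x; rewrite -[x]tlistK -tclass_cat. Qed.

Fact taddN : left_inverse (tclass [::]) (tmulr (-1)) tadd.
Proof.
move=> x; rewrite -[x]tlistK -tclass_scale -tclass_cat.
rewrite -{2}[tlist x]tscale1; apply/tclassP.
by apply: teq2_trans (teq2_sym (tscaleDl _ _ _)) _; rewrite addNr; apply: tscale0.
Qed.

HB.instance Definition _ := GRing.isZmodule.Build tensor taddA taddC tadd0 taddN.

Lemma tclassD s t : tclass (s ++ t) = tclass s + tclass t.
Proof. exact: tclass_cat. Qed.

Fact tmulrA a b x : tmulr a (tmulr b x) = tmulr (a * b) x.
Proof. by rewrite -[x]tlistK -!tclass_scale tscaleA. Qed.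

Fact tmul1r : left_id 1 tmulr.
Proof. by move=> x; rewrite -[x]tlistK -tclass_scale tscale1. Qed.

Fact tmulrDr : right_distributive tmulr +%R.
Proof.
move=> a x y; rewrite -[x]tlistK -[y]tlistK.
by rewrite -tclassD -!tclass_scale -tclassD /tscale map_cat.
Qed.

Fact tmulrDl x : {morph tmulr^~ x : a b / a + b}.
Proof.
move=> a b; rewrite -[x]tlistK -!tclass_scale -tclassD.
exact/tclassP/tscaleDl.
Qed.

HB.instance Definition _ :=
  GRing.Zmodule_isLmodule.Build K tensor tmulrA tmul1r tmulrDr tmulrDl.

Lemma tclassZ a s : tclass (tscale a s) = a *: tclass s.
Proof. exact: tclass_scale. Qed.

Definition pure (v : V) (w : W) : tensor := tclass [:: (v, w)].

Lemma tclass_sum s : tclass s = \sum_(p <- s) pure p.1 p.2.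
Proof.
elim: s => [|[v w] s IH]; first by rewrite big_nil.
by rewrite big_cons -cat1s tclassD IH.
Qed.

Lemma pure_bilin : bilin pure.
Proof.
split=> [w a v v'|v a w w'].
  rewrite -tclassZ -tclassD; apply/tclassP; exact: teq2_addl.
rewrite -tclassZ -tclassD; apply/tclassP.
apply: teq2_trans (teq2_addr _ _ _) _.
by rewrite -[_ :: _]cat1s; apply: (@teq2_cat _ _ _ _ _ [:: _] [:: _]);
  [apply/teq2_sym/teq2_scale|apply: teq2_refl].
Qed.

(** The map given by the universal property. It is computed on a chosen representative, a choice
    that does not matter for bilinear [b]. *)
Definition tlift (X : lmodType K) (b : V -> W -> X) (x : tensor) : X :=
  \sum_(p <- tlist x) b p.1 p.2.

Lemma tlift_class (X : lmodType K) (b : V -> W -> X) s : bilin b ->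
  tlift b (tclass s) = \sum_(p <- s) b p.1 p.2.
Proof. by move=> bB; apply: teq2_sum bB (tclassK s). Qed.

Lemma tlift_pure (X : lmodType K) (b : V -> W -> X) v w : bilin b ->
  tlift b (pure v w) = b v w.
Proof. by move=> bB; rewrite tlift_class // big_seq1. Qed.

Lemma tlift_linear (X : lmodType K) (b : V -> W -> X) :
  bilin b -> klinear (tlift b).
Proof.
move=> bB a x y; rewrite -[x]tlistK -[y]tlistK.
rewrite -tclassZ -tclassD !tlift_class // big_cat.
rewrite big_map scaler_sumr; congr (_ + _).
by apply: eq_bigr => p _; rewrite (klinZ (bB.1 _)).
Qed.

End TensorSpace.

(** * Hopf algebras and comodules *)

Ltac linear_step :=
  first
  [ assumption
  | exact: klinear_id
  | apply: kfunctional_bigsum => ?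
  | apply: klinear_sum => ?
  | apply: kfunctional_mull
  | apply: kfunctional_mulr
  | apply: klinear_mull
  | apply: klinear_mulr
  | apply: klinear_scalel
  | apply: klinear_scaler
  | match goal with
    | |- kfunctional (fun x => ?f (@?g x)) => apply: (@kfunctional_comp _ _ _ f g)
    | |- klinear (fun x => ?f (@?g x)) => apply: (@klinear_comp _ _ _ _ f g)
    end ].
Ltac linear := repeat linear_step.
Ltac multilinear := split => * /=; linear.

Section HopfTheory.
Variables (K : fieldType) (H : algType K).
Variables (D : H -> seq (H * H)) (e : H -> K) (S : H -> H).
Hypothesis hopfH : is_hopf D e S.

Let eL : kfunctional e := hopf_e_lin hopfH.
Let SL : klinear S := hopf_S_lin hopfH.

Lemma comul_linear (X : lmodType K) (b : H -> H -> X) : bilin b ->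
  klinear (fun h => \sum_(p <- D h) b p.1 p.2).
Proof. exact: teq2_linear_sum (hopf_D_lin hopfH). Qed.

Lemma comul_coassoc (X : lmodType K) (b : H -> H -> H -> X) h : trilin b ->
  \sum_(p <- D h) \sum_(q <- D p.1) b q.1 q.2 p.2 =
  \sum_(p <- D h) \sum_(q <- D p.2) b p.1 q.1 q.2.
Proof.
by move=> bT; have := teq3_sum bT (hopf_coassoc hopfH h); rewrite !big_allpairs_dep.
Qed.

Lemma comul_mul (X : lmodType K) (b : H -> H -> X) h g : bilin b ->
  \sum_(p <- D (h * g)) b p.1 p.2 =
  \sum_(p <- D h) \sum_(q <- D g) b (p.1 * q.1) (p.2 * q.2).
Proof.
by move=> bB; rewrite (teq2_sum bB (hopf_D_mul hopfH h g)) big_allpairs_dep.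
Qed.

Lemma comul_one (X : lmodType K) (b : H -> H -> X) : bilin b ->
  \sum_(p <- D 1) b p.1 p.2 = b 1 1.
Proof. by move=> bB; rewrite (teq2_sum bB (hopf_D_one hopfH)) big_seq1. Qed.

Lemma counit_unit : e 1 = 1. Proof. exact: hopf_e_one hopfH. Qed.

Lemma hopf_one_neq0 : (1 : H) != 0.
Proof.
apply/eqP => one0; have := counit_unit.
by rewrite one0 (klin0 (kfunctional_klinear eL)) => /esym/eqP; rewrite oner_eq0.
Qed.

(** * Coefficient matrices of finite dimensional comodules *)

Section Comatrix.
Variable n : nat.
Implicit Types C : 'I_n -> 'I_n -> H.

(** In matrix form, the counit sends [C] to the identity matrix and [Delta C = C (x) C], as for the
    coefficients of a coaction on an [n]-dimensional space. *)
Definition comatrix C :=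
  (forall i j, e (C i j) = (i == j)%:R) /\
  (forall i j, tclass (D (C i j)) = \sum_k pure (C i k) (C k j)).

Lemma comatrix_sum C (X : lmodType K) (b : H -> H -> X) i j :
  comatrix C -> bilin b ->
  \sum_(p <- D (C i j)) b p.1 p.2 = \sum_k b (C i k) (C k j).
Proof.
move=> [_ CD] bB; rewrite -tlift_class // CD (klin_bigsum (tlift_linear bB)).
by apply: eq_bigr => k _; rewrite tlift_pure.
Qed.

Lemma comatrix_antipode_l C i j :
  comatrix C -> \sum_k S (C i k) * C k j = (i == j)%:R.
Proof.
move=> CC; rewrite -(@comatrix_sum C H (fun x y => S x * y)) //; last by multilinear.
by rewrite (hopf_antipode_l hopfH) CC.1 scaler_nat.
Qed.

Lemma comatrix_antipode_r C i j :
  comatrix C -> \sum_k C i k * S (C k j) = (i == j)%:R.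
Proof.
move=> CC; rewrite -(@comatrix_sum C H (fun x y => x * S y)) //; last by multilinear.
by rewrite (hopf_antipode_r hopfH) CC.1 scaler_nat.
Qed.

Lemma sum_delta (X : lmodType K) (F : 'I_n -> X) i :
  \sum_j (i == j)%:R *: F j = F i.
Proof.
rewrite (bigD1 i) //= eqxx scale1r big1 ?addr0 // => j ji.
by rewrite eq_sym (negPf ji) scale0r.
Qed.

Lemma sum_delta_mulr (X : lmodType K) (F : 'I_n -> H -> X) (h : H) i :
  (forall j, klinear (F j)) -> \sum_j F j (h * (i == j)%:R) = F i h.
Proof.
move=> FL; rewrite -(sum_delta (fun j => F j h)); apply: eq_bigr => j _.
by rewrite -(klinZ (FL j)) mulr_natr scaler_nat.
Qed.

(* The matrix [(Delta (S (C i j)))] is the inverse of [Delta C], which is also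
   inverted by [(\sum_k S (C k j) (x) S (C i k))]. *)
Lemma comatrix_antipode C : comatrix C -> comatrix (fun i j => S (C j i)).
Proof.
move=> CC; split=> [i j|l i].
  have ekL := kfunctional_klinear eL.
  have := congr1 e (comatrix_antipode_l j i CC).
  rewrite (klin_bigsum ekL) -[(_ == _)%:R]scaler_nat (klinZ ekL) counit_unit.
  rewrite [_ *: _]mulr1 eq_sym => <-.
  under [RHS]eq_bigr => k _ do rewrite (hopf_e_mul hopfH) CC.1 mulrC.
  under [RHS]eq_bigr => k _ do rewrite eq_sym.
  exact: (esym (@sum_delta K^o _ _)).
have [pL1 pL2] := pure_bilin H H.
(* Right multiplication of [Delta x] by a summand of the candidate inverse of [Delta C]. *)
pose Phi m k x := \sum_(z <- D x) pure (z.1 * S (C k l)) (z.2 * S (C m k)).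
have PhiB m k : bilin (fun x y => pure (x * S (C k l)) (y * S (C m k))).
  by refine (bilin_comp (pure_bilin H H) _ _); linear.
have PhiL m k : klinear (Phi m k) := comul_linear (PhiB m k).
(* The identity matrix is written as [C] times [S C], once in each tensor factor. This creates the
   factor [Delta (C j m)], which the sum over [j] then combines with [Delta (S (C i j))] into
   [Delta] of an entry of the identity. *)
have expand j (q : H * H) :
  pure (q.1 * (l == j)%:R) q.2 = \sum_k \sum_m \sum_k'
     pure (q.1 * C j k' * S (C k l)) (q.2 * C k' m * S (C m k)).
  rewrite eq_sym -(comatrix_antipode_r j l CC) mulr_sumr (klin_bigsum (pL1 _)).
  apply: eq_bigr => k _; rewrite exchange_big /=.
  rewrite mulrA.
  pose F k' (y : H) := pure (q.1 * C j k' * S (C k l)) y.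
  transitivity (\sum_k' F k' (q.2 * (k == k')%:R)).
    by rewrite sum_delta_mulr // => k'; apply: pL2.
  apply: eq_bigr => k' _; rewrite /F.
  rewrite eq_sym -(comatrix_antipode_r k' k CC) mulr_sumr (klin_bigsum (pL2 _)).
  by apply: eq_bigr => m _; rewrite mulrA.
rewrite tclass_sum.
transitivity (\sum_j \sum_(q <- D (S (C i j))) pure (q.1 * (l == j)%:R) q.2).
  rewrite -(sum_delta (fun j => \sum_(q <- D (S (C i j))) pure q.1 q.2) l).
  apply: eq_bigr => j _; rewrite scaler_sumr; apply: eq_bigr => q _.
  by rewrite -(klinZ (pL1 _)) mulr_natr scaler_nat.
transitivity (\sum_k \sum_m Phi m k (i == m)%:R); last first.
  apply: eq_bigr => k _.
  under eq_bigr => m _ do rewrite -[(_ == _)%:R]mul1r.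
  rewrite (@sum_delta_mulr _ (fun m => Phi m k)) => [|m]; last exact: PhiL.
  by rewrite /Phi (comul_one (PhiB i k)) !mul1r.
under eq_bigr => j _.
  under eq_bigr => q _ do rewrite expand.
  rewrite exchange_big /=; under eq_bigr => k _ do rewrite exchange_big /=.
  over.
rewrite exchange_big /=; apply: eq_bigr => k _.
rewrite exchange_big /=; apply: eq_bigr => m _.
rewrite -(comatrix_antipode_l i m CC) (klin_bigsum (PhiL m k)).
apply: eq_bigr => j _; rewrite /Phi (comul_mul _ _ (PhiB m k)).
apply: eq_bigr => q _.
rewrite (@comatrix_sum C _
  (fun x y => pure (q.1 * x * S (C k l)) (q.2 * y * S (C m k)))) //.
refine (bilin_comp (pure_bilin H H) _ _); linear.
Qed.

End Comatrix.

(** * Coactions, the regular comodule and its injectivity *)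

Section Comodules.

Section Coaction.
Variables (M : lmodType K) (rho : M -> seq (H * M)).
Hypothesis rhoC : is_comodule D e rho.

Lemma coact_linear (X : lmodType K) (b : H -> M -> X) : bilin b ->
  klinear (fun m => \sum_(p <- rho m) b p.1 p.2).
Proof. by case: rhoC => rhoL _ _; apply: teq2_linear_sum rhoL. Qed.

Lemma coact_coassoc (X : lmodType K) (b : H -> H -> M -> X) m : trilin b ->
  \sum_(p <- rho m) \sum_(q <- D p.1) b q.1 q.2 p.2 =
  \sum_(p <- rho m) \sum_(q <- rho p.2) b p.1 q.1 q.2.
Proof.
move=> bT; case: rhoC => _ /(_ m)/(teq3_sum bT) + _.
by rewrite !big_allpairs_dep.
Qed.

Lemma coact_counit m : \sum_(p <- rho m) e p.1 *: p.2 = m.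
Proof. by case: rhoC. Qed.

End Coaction.

Lemma regular_is_comodule : is_comodule D e D.
Proof.
by split; [apply: hopf_D_lin hopfH|apply: hopf_coassoc hopfH
          |apply: hopf_counit_l hopfH].
Qed.

Definition regular_comodule : comodule D e := Comodule regular_is_comodule.

(** A comodule map [f] into [H] is recovered from the functional [e f] as
    [m |-> e(f(m_(0))) m_(-1)]. Hence it is enough to extend [e f] linearly from [A] to [B]. *)
Lemma regular_injective : injective_comod regular_comodule.
Proof.
move=> A B i f [iL iC] iI [fL fC].
have [g [gL gi]] := extend_functional iL iI (kfunctional_comp eL fL).
have BC := cm_ax B.
pose b (h : H) m := g m *: h.
have bB : bilin b by multilinear.
exists (fun m => \sum_(p <- cm_coact m) b p.1 p.2); split=> [|x].
  split=> [|m]; first exact: coact_linear.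
  apply/tclassP; rewrite !tclass_sum big_map.
  have [pL1 pL2] := pure_bilin H H.
  have DL := comul_linear (pure_bilin H H); rewrite (klin_bigsum DL).
  transitivity (\sum_(p <- cm_coact m) \sum_(q <- D p.1) g p.2 *: pure q.1 q.2).
    by apply: eq_bigr => p _; rewrite -scaler_sumr; apply: klinZ DL _ _.
  rewrite (@coact_coassoc _ _ BC _ (fun x y z => g z *: pure x y)).
    apply: eq_bigr => p _; rewrite (klin_bigsum (pL2 _)).
    by apply: eq_bigr => q _; rewrite (klinZ (pL2 _)).
  by split=> [y z|x z|x y];
    [apply/klinear_scaler/pL1|apply/klinear_scaler/pL2|apply: klinear_scalel].
rewrite (teq2_sum bB (iC x)) big_map.
under eq_bigr => p _ do rewrite /b /= gi.
have eB : bilin (fun (x y : H) => e y *: x) by multilinear.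
have := teq2_sum eB (fC x); rewrite big_map => <-.
exact: hopf_counit_r hopfH _.
Qed.

(** * Cofree comodules *)

Section Cofree.
Variable M : lmodType K.

(** This is [Delta (x) id] at the level of lists. The coaction applies it to a chosen
    representative, and [cofree_coact_class] shows that any other list will do. *)
Definition cofree_list (s : seq (H * M)) : seq (H * tensor H M) :=
  [seq (q.1, pure q.2 p.2) | p <- s, q <- D p.1].

Definition cofree_coact (x : tensor H M) := cofree_list (tlist x).

Definition cofree_bi (h : H) (m : M) : tensor H (tensor H M) :=
  \sum_(q <- D h) pure q.1 (pure q.2 m).

Lemma cofree_bi_bilin : bilin cofree_bi.
Proof.
split=> [m|h].
  apply: (@comul_linear _ (fun x y => pure x (pure y m))).
  refine (bilin_comp (pure_bilin _ _) _ _); linear.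
  exact: (pure_bilin H M).1.
apply: klinear_sum => q; apply: (@klinear_comp _ _ _ _ (pure q.1) (pure q.2)).
  exact: (pure_bilin _ _).2.
exact: (pure_bilin _ _).2.
Qed.

Lemma tclass_cofree_list s :
  tclass (cofree_list s) = \sum_(p <- s) cofree_bi p.1 p.2.
Proof. by rewrite tclass_sum big_allpairs_dep. Qed.

Lemma cofree_coact_class s : teq2 (cofree_coact (tclass s)) (cofree_list s).
Proof.
apply/tclassP; rewrite !tclass_cofree_list.
exact: teq2_sum cofree_bi_bilin (tclassK s).
Qed.

Lemma cofree_is_comodule : is_comodule D e cofree_coact.
Proof.
have [pL1 pL2] := pure_bilin H M.
split.
- move=> a x y; apply/tclassP; rewrite tclassD tclassZ !tclass_cofree_list.
  exact: tlift_linear cofree_bi_bilin a x y.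
- move=> x; rewrite /cofree_coact; elim: (tlist x) => [|[h m] s IH].
    exact: teq3_refl.
  rewrite /cofree_list /= !map_cat !flatten_cat; apply: teq3_cat IH.
  (* On a pure tensor, coassociativity is that of [D] with [m] attached to the third leg; what
     remains is to replace the chosen representatives. *)
  have FE := teq3_map3 (pL1 m) (hopf_coassoc hopfH h).
  rewrite !map_flatten -!map_comp in FE.
  rewrite -!map_comp.
  apply: teq3_trans (teq3_trans FE _).
    rewrite (_ : flatten _ = flatten [seq [seq (z.1.1, z.1.2, pure z.2 m)
       | z <- [seq (q.1, q.2, p.2) | q <- D p.1]] | p <- D h]).
      exact: teq3_refl.
    by congr flatten; apply: eq_map => p /=; rewrite -map_comp.
  apply: teq3_pointwise => p /=.
  have := teq2_teq3 p.1 (cofree_coact_class [:: (p.2, m)]).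
  move/teq3_sym; apply: teq3_trans.
  rewrite /cofree_list /= cats0 -!map_comp; exact: teq3_refl.
- move=> x; rewrite big_allpairs_dep /= -[RHS]tlistK tclass_sum.
  apply: eq_bigr => p _; rewrite -[X in pure X _](hopf_counit_l hopfH).
  rewrite (klin_bigsum (pL1 _)); apply: eq_bigr => q _.
  by rewrite (klinZ (pL1 _)).
Qed.

Definition cofree : comodule D e := Comodule cofree_is_comodule.

End Cofree.

Section CofreeEmbedding.
Variable M : comodule D e.

(** The coaction itself, seen as an embedding: coassociativity makes it a comodule map, and the
    counit axiom makes it injective. *)
Definition cofree_unit (m : cm_space M) : cm_space (cofree (cm_space M)) :=
  tclass (cm_coact m).

Lemma cofree_unit_mor : comod_mor cofree_unit.
Proof.
have MC := cm_ax M.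
split=> [a x y|m].
  rewrite /cofree_unit !tclass_sum.
  exact: (coact_linear MC (pure_bilin H (cm_space M))).
apply: teq2_trans (cofree_coact_class _) _; apply/tclassP.
rewrite tclass_cofree_list tclass_sum big_map /cofree_bi.
rewrite (@coact_coassoc _ _ MC _ (fun x y z => pure x (pure y z))).
  apply: eq_bigr => p _; rewrite /cofree_unit tclass_sum.
  by rewrite (klin_bigsum ((pure_bilin _ _).2 _)).
have [pL1 pL2] := pure_bilin H (tensor H (cm_space M)).
have [qL1 qL2] := pure_bilin H (cm_space M).
split=> [y z|x z|x y]; first exact: pL1.
  exact: klinear_comp (pL2 x) (qL1 z).
exact: klinear_comp (pL2 x) (qL2 y).
Qed.

Lemma cofree_unit_inj : injective cofree_unit.
Proof.
move=> x y xy; have MC := cm_ax M.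
have eB : bilin (fun (h : H) (m : cm_space M) => e h *: m) by multilinear.
rewrite -(coact_counit MC x) -(coact_counit MC y).
exact: teq2_sum eB ((tclassP _ _).1 xy).
Qed.

End CofreeEmbedding.

End Comodules.

(** * From a nonzero integral to finite dimensional quotients *)

Section FromIntegral.
Variables (I : H -> K) (h0 : H).
Hypothesis IL : kfunctional I.
Hypothesis I_int : forall h, \sum_(p <- D h) I p.2 *: p.1 = (I h)%:A.
Hypothesis Ih0 : I h0 != 0.

(** Both sides equal [S(y_(1)) y_(2) h_(1) I(y_(3) h_(2))]: the integral property of [y_(2) h] gives
    the right side, the antipode axiom the left. *)
Lemma integral_shift y h :
  \sum_(p <- D h) I (y * p.2) *: p.1 = \sum_(q <- D y) I (q.2 * h) *: S q.1.
Proof.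
pose b (u v w : H) := \sum_(p <- D h) I (w * p.2) *: (S u * (v * p.1)).
transitivity (\sum_(q <- D y) \sum_(r <- D q.2) b q.1 r.1 r.2); last first.
  apply: eq_bigr => q _; rewrite -[S q.1 in RHS]mulr1 scalerAr -I_int mulr_sumr.
  under [RHS]eq_bigr => z _ do rewrite -scalerAr.
  by rewrite (@comul_mul _ (fun x z => I z *: (S q.1 * x))) //; multilinear.
rewrite -(@comul_coassoc _ b); last by split=> * /=; linear.
transitivity (\sum_(q <- D y) \sum_(p <- D h) I (q.2 * p.2) *: (e q.1 *: p.1)).
  rewrite exchange_big /=; apply: eq_bigr => p _.
  rewrite -{1}[y](hopf_counit_l hopfH) mulr_suml.
  rewrite (kfun_bigsum _ _ IL) scaler_suml.
  apply: eq_bigr => q _; rewrite -scalerAl (kfunZ _ _ IL).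
  by rewrite scalerA mulrC.
apply: eq_bigr => q _; rewrite exchange_big /=; apply: eq_bigr => p _.
rewrite -scaler_sumr; congr (_ *: _).
under [RHS]eq_bigr => r _ do rewrite mulrA.
by rewrite -mulr_suml (hopf_antipode_l hopfH) -scalerAl mul1r.
Qed.

Variable M : comodule D e.
Let MC := cm_ax M.
Let rho := @cm_coact K H D e M.

Lemma integral_pairing_nonzero : nonzero_comod M ->
  exists y m, \sum_(p <- rho m) I (y * p.1) *: p.2 != 0.
Proof.
move=> [m /eqP m0]; apply: contrapT => no; apply: m0.
have zero y v : \sum_(p <- rho v) I (y * p.1) *: p.2 = 0.
  by apply/eqP; apply: contrapT => /negP ne; apply: no; exists y, v.
suff : I h0 *: m = 0 by move/eqP; rewrite scaler_eq0 (negPf Ih0) => /eqP.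
(* Each inner sum is a pairing with [y = h0 * S p.1], hence zero, while coassociativity and the
   antipode collapse the whole to [I h0 *: m]. *)
transitivity (\sum_(p <- rho m) \sum_(q <- rho p.2) I (h0 * S p.1 * q.1) *: q.2).
  rewrite -(@coact_coassoc _ _ MC _ (fun x y z => I (h0 * S x * y) *: z)).
    rewrite -[m in LHS](coact_counit MC) scaler_sumr; apply: eq_bigr => p _.
    rewrite -scaler_suml -(kfun_bigsum _ _ IL).
    under [X in I X *: p.2]eq_bigr => q _ do rewrite -mulrA.
    rewrite -mulr_sumr (hopf_antipode_l hopfH) -scalerAr mulr1.
    by rewrite (kfunZ _ _ IL) scalerA mulrC.
  by split=> * /=; linear.
by rewrite big1 // => p _; apply: zero.
Qed.

(* The target [H] is regarded as a left comodule through
   [y |-> S y_(2) (x) y_(1)]. *)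
Definition average (psi : cm_space M -> K) (y : H) (v : cm_space M) : H :=
  \sum_(q <- D y) (\sum_(p <- rho v) psi p.2 * I (q.2 * p.1)) *: q.1.

Variables (psi : cm_space M -> K) (y : H).
Hypothesis psiL : kfunctional psi.

Let theta (q : H * H) (v : cm_space M) : K :=
  \sum_(p <- rho v) psi p.2 * I (q.2 * p.1).

Lemma theta_linear q : kfunctional (theta q).
Proof.
exact: (coact_linear MC (b := fun x z => psi z * I (q.2 * x) : K^o)
  ltac:(split=> ?; [apply: kfunctional_mull|apply: kfunctional_mulr]; linear)).
Qed.

Lemma average_linear : klinear (average psi y).
Proof. by apply: klinear_sum => q; apply/klinear_scalel/theta_linear. Qed.

(** This detects that the average is nonzero: [psi] can be chosen to be [1] on a nonzero pairing. *)
Lemma counit_average v :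
  e (average psi y v) = psi (\sum_(p <- rho v) I (y * p.1) *: p.2).
Proof.
rewrite (kfun_bigsum _ _ eL) (kfun_bigsum _ _ psiL).
under eq_bigr => q _ do rewrite (kfunZ _ _ eL) mulr_suml.
rewrite exchange_big /=; apply: eq_bigr => p _; rewrite (kfunZ _ _ psiL).
rewrite -[X in I (X * _)](hopf_counit_l hopfH) mulr_suml (kfun_bigsum _ _ IL).
rewrite mulr_suml; apply: eq_bigr => q _.
by rewrite -scalerAl (kfunZ _ _ IL) mulrC [psi _ * _]mulrC mulrA.
Qed.

(** Colinearity for the coaction through [S], with the coacting leg evaluated by [f] so that no
    tensors occur. The key step is [integral_shift]. *)
Lemma average_comodule_map (f : H -> K) v : kfunctional f ->
  \sum_(p <- rho v) f p.1 *: average psi y p.2 =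
  \sum_(s <- D (average psi y v)) f (S s.2) *: s.1.
Proof.
move=> fL.
have bB : bilin (fun s t : H => f (S t) *: s) by multilinear.
rewrite (klin_bigsum (comul_linear bB)).
(* The common value is [psi(v_(0)) I(y_(3) v_(-1)) f(S(y_(2))) y_(1)]. *)
transitivity (\sum_(q <- D y) \sum_(p <- rho v) \sum_(s <- D q.2)
    (psi p.2 * I (s.2 * p.1) * f (S s.1)) *: q.1).
  rewrite exchange_big /=.
  transitivity (\sum_(p <- rho v) \sum_(r <- rho p.2) \sum_(q <- D y)
     (f p.1 * (psi r.2 * I (q.2 * r.1))) *: q.1).
    apply: eq_bigr => p _; rewrite exchange_big scaler_sumr /=.
    apply: eq_bigr => q _; rewrite scalerA mulr_sumr scaler_suml.
    by apply: eq_bigr => r _.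
  rewrite -(@coact_coassoc _ _ MC _ (fun x z w => \sum_(q <- D y)
     (f x * (psi w * I (q.2 * z))) *: q.1)); last by split=> * /=; linear.
  apply: eq_bigr => p _; rewrite exchange_big /=; apply: eq_bigr => q _.
  rewrite -!scaler_suml; congr (_ *: _).
  transitivity (psi p.2 * f (\sum_(r <- D p.1) I (q.2 * r.2) *: r.1)).
    rewrite (kfun_bigsum _ _ fL) mulr_sumr; apply: eq_bigr => r _.
    by rewrite (kfunZ _ _ fL) mulrC -mulrA.
  rewrite integral_shift (kfun_bigsum _ _ fL) mulr_sumr; apply: eq_bigr => r _.
  by rewrite (kfunZ _ _ fL) mulrA.
pose b (u w z : H) := \sum_(p <- rho v) (psi p.2 * I (z * p.1) * f (S w)) *: u.
transitivity (\sum_(q <- D y) \sum_(s <- D q.2) b q.1 s.1 s.2).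
  by apply: eq_bigr => q _; rewrite exchange_big.
rewrite -(@comul_coassoc _ b); last by split=> * /=; linear.
apply: eq_bigr => q _.
rewrite (klinZ (comul_linear bB)) scaler_sumr; apply: eq_bigr => s _.
by rewrite /b -scaler_suml scalerA -mulr_suml.
Qed.

(** Once the [H]-legs of [rho v] are expanded in a basis [x] with dual functionals [f], the other
    legs are [f_i(v_(-1)) v_(0)], and [average_comodule_map] puts them in the kernel. *)
Lemma average_kernel_subcomodule : subcomodule (fun v => average psi y v = 0).
Proof.
split=> [|a u v u0 v0|v v0].
- exact: klin0 average_linear.
- by rewrite average_linear u0 v0 scaler0 addr0.
have [n [x [f [fL _ _ fx]]]] :=
  dual_basis_mod [seq p.1 | p <- rho v] (zero_subspace H).
exists [seq (x i, \sum_(p <- rho v) f i p.1 *: p.2) | i <- enum 'I_n].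
split=> [_ /mapP[i _ ->] /=|].
  rewrite (klin_bigsum average_linear).
  under eq_bigr => p _ do rewrite (klinZ average_linear).
  rewrite average_comodule_map // v0.
  have bB : bilin (fun s t : H => f i (S t) *: s) by multilinear.
  exact: klin0 (comul_linear bB).
have [pL1 pL2] := pure_bilin H (cm_space M).
apply/tclassP; rewrite !tclass_sum big_map big_enum /=.
under [RHS]eq_bigr => i _ do rewrite (klin_bigsum (pL2 _)).
rewrite exchange_big /=; apply: eq_big_seq => p pv.
have /eqP := fx p.1 (map_f _ pv); rewrite subr_eq0 => /eqP {1}->.
rewrite (klin_bigsum (pL1 _)); apply: eq_bigr => i _.
by rewrite (klinZ (pL1 _)) (klinZ (pL2 _)).
Qed.

End FromIntegral.

(** The quotient is by the kernel of the average. This kernel contains the common kernel of the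
    functionals [theta q], one for each of the finitely many terms [q] of [D y]. *)
Lemma co_Frobenius_fd_quotient : co_Frobenius D ->
  forall M : comodule D e, nonzero_comod M -> has_nonzero_fd_quotient M.
Proof.
move=> [I [[IL Iint] [h0 Ih0]]] M Mn0.
have [y [m w0]] := integral_pairing_nonzero IL Ih0 Mn0.
have [psi [psiL psiw]] := nonzero_functional w0.
exists (fun v => average I psi y v = 0); split.
- exact: average_kernel_subcomodule.
- exists m => m0; have := counit_average IL y psiL m.
  rewrite m0 psiw (klin0 (kfunctional_klinear eL)) => /esym/eqP.
  by rewrite oner_eq0.
pose theta (q : H * H) v := \sum_(p <- cm_coact v) psi p.2 * I (q.2 * p.1).
have tL i : kfunctional (nth (fun _ => 0) [seq theta q | q <- D y] i).
  have [lt_i|ge_i] := ltnP i (size (D y)).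
    by rewrite (nth_map 0) //; exact: theta_linear.
  by rewrite nth_default ?size_map // => a u v; rewrite mulr0 addr0.
have [ms msP] := common_kernel_cofinite tL.
exists ms => v; have [c cP] := msP v; exists c.
rewrite /average big_seq big1 // => q qy.
have := cP (index q (D y)).
rewrite (nth_map 0) ?index_mem // nth_index // /theta => ->.
by rewrite scale0r.
Qed.

(** * From a finite dimensional quotient of an injective comodule to an integral *)

Section FromQuotient.
Variable M : comodule D e.
Let MC := cm_ax M.
Let rho := @cm_coact K H D e M.

(* [f] is a coordinate system on the quotient, [C] its coefficient matrix. *)
Lemma fd_quotient_comatrix : has_nonzero_fd_quotient M ->
  exists n (f : 'I_n -> cm_space M -> K) (C : 'I_n -> 'I_n -> H),
    [/\ forall i, kfunctional (f i), comatrix C,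
        forall i v, \sum_(p <- rho v) f i p.2 *: p.1 = \sum_j f j v *: C j i
      & exists i v, f i v != 0].
Proof.
move=> [N [[N0 NL Nsub] [m Nm] [ms msP]]].
have NS : subspace N by split.
have [n [x [f [fL fN fx fms]]]] := dual_basis_mod ms NS.
(* The property passes from [ms] to all [v] by linearity, since [v] is a combination of [ms] modulo
   [N], and the [f i] vanish on [N]. *)
have fxP v : N (v - \sum_i f i v *: x i).
  have [c Nc] := msP v; set w := \sum_(i < _) _ in Nc.
  have pL : klinear (fun v => v - \sum_i f i v *: x i).
    by apply: klinear_sub => //; apply: klinear_sum => i; apply: klinear_scalel.
  rewrite -(subrK (v - w) v) (_ : v - (v - w) = w); last by rewrite subKr.
  rewrite (klinD pL); apply: (subspaceD NS); last first.
    by rewrite big1 ?subr0 // => i _; rewrite fN // scale0r.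
  rewrite (klin_bigsum pL); apply: (subspace_sum NS) => i.
  by rewrite (klinZ pL); apply/(subspaceZ NS)/fms/mem_nth.
have coefB i : bilin (fun (h : H) v => f i v *: h).
  by have := fL i; multilinear.
pose C j i := \sum_(p <- rho (x j)) f i p.2 *: p.1.
(* True for [v = x j] by the choice of [C]; on [N] the left side vanishes because [N] is a
   subcomodule. *)
have CE i v : \sum_(p <- rho v) f i p.2 *: p.1 = \sum_j f j v *: C j i.
  have cL := coact_linear MC (coefB i).
  have := klinD cL (v - \sum_j f j v *: x j) (\sum_j f j v *: x j).
  rewrite subrK => ->; have [t [tN vt]] := Nsub _ (fxP v).
  rewrite (teq2_sum (coefB i) vt) big_seq big1 ?add0r => [|p pt]; last first.
    by rewrite fN ?scale0r //; apply: tN.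
  rewrite (klin_bigsum cL); apply: eq_bigr => j _; exact: klinZ cL _ _.
exists n, f, C; split=> //; last first.
  apply: contrapT => no; apply: Nm; have := fxP m.
  rewrite big1 ?subr0 // => i _; have [->|fi] := eqVneq (f i m) 0.
    by rewrite scale0r.
  by case: no; exists i, m.
split=> [j i|j i].
  rewrite (kfun_bigsum _ _ eL) eq_sym -fx -[x j in RHS](coact_counit MC).
  rewrite (kfun_bigsum _ _ (fL i)); apply: eq_bigr => p _.
  by rewrite (kfunZ _ _ eL) (kfunZ _ _ (fL i)) mulrC.
have [pL1 pL2] := pure_bilin H H; have DL := comul_linear (pure_bilin H H).
rewrite tclass_sum (klin_bigsum DL).
transitivity (\sum_(p <- rho (x j)) \sum_(q <- D p.1) f i p.2 *: pure q.1 q.2).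
  by apply: eq_bigr => p _; rewrite -scaler_sumr; apply: klinZ DL _ _.
rewrite (@coact_coassoc _ _ MC _ (fun u v w => f i w *: pure u v)); last first.
  by have := fL i => fLi; split=> [v w|u w|u v];
    [apply/klinear_scaler/pL1|apply/klinear_scaler/pL2|apply: klinear_scalel].
transitivity (\sum_(p <- rho (x j)) \sum_k f k p.2 *: pure p.1 (C k i)).
  apply: eq_bigr => p _.
  transitivity (pure p.1 (\sum_(q <- rho p.2) f i q.2 *: q.1)).
    rewrite (klin_bigsum (pL2 _)); apply: eq_bigr => q _.
    by rewrite (klinZ (pL2 _)).
  rewrite CE (klin_bigsum (pL2 _)); apply: eq_bigr => k _.
  by rewrite (klinZ (pL2 _)).
rewrite exchange_big /=; apply: eq_bigr => k _.
rewrite (klin_bigsum (pL1 _)); apply: eq_bigr => p _.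
by rewrite (klinZ (pL1 _)).
Qed.

(* [M] is a retract of a cofree comodule, so the projection [M -> M / N]
   induces a nonzero comodule map [H -> M / N]. *)
Lemma injective_quotient_map :
  injective_comod M -> has_nonzero_fd_quotient M ->
  exists n (f : 'I_n -> H -> K) (C : 'I_n -> 'I_n -> H),
    [/\ forall i, kfunctional (f i), comatrix C,
        forall i h, \sum_(p <- D h) f i p.2 *: p.1 = \sum_j f j h *: C j i
      & exists i h, f i h != 0].
Proof.
move=> Minj /fd_quotient_comatrix[n [f [C [fL CC fC [i [m fim]]]]]].
have idM : comod_mor (fun v : cm_space M => v).
  split=> // v; rewrite (_ : [seq _ | _ <- _] = cm_coact v); first exact: teq2_refl.
  by rewrite -[RHS]map_id; apply: eq_map => -[].
have [r [[rL rC] rK]] :=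
  Minj _ _ _ _ (cofree_unit_mor M) (@cofree_unit_inj M) idM.
have [pL1 pL2] := pure_bilin H (cm_space M).
(* Pure tensors span, so the composite is nonzero on one of them. Fixing its second factor [v] gives
   the map from [H], as [x |-> x (x) v] is colinear. *)
have [[h v] fhv] : exists p : H * cm_space M, f i (r (pure p.1 p.2)) != 0.
  apply: contrapT => no; move: fim; rewrite -[m]rK /cofree_unit tclass_sum.
  rewrite (klin_bigsum rL) (kfun_bigsum _ _ (fL i)) big1 ?eqxx // => p _.
  by apply/eqP; apply: contrapT => /negP ne; apply: no; exists p.
exists n, (fun j x => f j (r (pure x v))), C; split=> //.
- by move=> j a x y; rewrite (pL1 v) rL fL.
- move=> j x.
  have coefB : bilin (fun (x : H) w => f j w *: x) by have := fL j; multilinear.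
  rewrite -fC (teq2_sum coefB (rC _)) big_map /=.
  have rB : bilin (fun (x : H) t => f j (r t) *: x).
    by have fLj := fL j; split=> ? /=; linear.
  rewrite (teq2_sum rB (cofree_coact_class _)) big_allpairs_dep big_seq1.
  by [].
- by exists i, h.
Qed.

(* With [E] the antipode transpose of [C] and [G = S E], the functionals
   [h |-> \sum_j f j (h * G l j)] are left integrals from which [f] can be
   recovered since [G] is inverse to the transpose of [E]. *)
Lemma injective_co_Frobenius :
  injective_comod M -> has_nonzero_fd_quotient M -> co_Frobenius D.
Proof.
move=> Minj /(injective_quotient_map Minj)[n [f [C [fL CC fC [i0 [h0 fh0]]]]]].
pose E i j := S (C j i); have EC : comatrix E := comatrix_antipode CC.
pose G i j := S (E i j).
(* The two transpositions cancel: the entries of this matrix are [S (S (C i j))]. *)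
have GC : comatrix (fun i j => G j i) := comatrix_antipode EC.
pose I l h := \sum_j f j (h * G l j).
have IL l : kfunctional (I l).
  by apply: kfunctional_bigsum => j; have fLj := fL j; linear.
have Iint l h : \sum_(p <- D h) I l p.2 *: p.1 = (I l h)%:A.
  (* On the left, [(k == j)%:R] is inserted as [\sum_i G k i * E i j]; the factors [G k i] and
     [G l k] then assemble into [D (G l i)]. *)
  transitivity (\sum_i \sum_j (\sum_(z <- D (h * G l i)) f j z.2 *: z.1) * E i j).
    transitivity (\sum_j \sum_k \sum_(p <- D h)
        f j (p.2 * G l k) *: (p.1 * (k == j)%:R)).
      under eq_bigr => p _ do rewrite scaler_suml.
      rewrite exchange_big /=; apply: eq_bigr => j _.
      rewrite exchange_big /=; apply: eq_bigr => p _.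
      rewrite -(sum_delta (fun k => f j (p.2 * G l k) *: p.1)).
      apply: eq_bigr => k _; rewrite eq_sym mulr_natr -scaler_nat !scalerA.
      by rewrite mulrC.
    rewrite [RHS]exchange_big /=; apply: eq_bigr => j _.
    have fLj := fL j.
    under [RHS]eq_bigr => i _.
      rewrite (@comul_mul _ (fun x y => f j y *: x)); last by multilinear.
      under eq_bigr => p _.
        rewrite (@comatrix_sum _ (fun i j => G j i) _
          (fun x y => f j (p.2 * y) *: (p.1 * x))) //; last by multilinear.
        over.
      rewrite exchange_big mulr_suml /=.
      over.
    rewrite [RHS]exchange_big /=; apply: eq_bigr => k _.
    rewrite -(comatrix_antipode_l k j EC).
    under eq_bigr => p _ do rewrite mulr_sumr scaler_sumr.
    rewrite exchange_big /=; apply: eq_bigr => i _.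
    rewrite mulr_suml; apply: eq_bigr => p _.
    by rewrite -scalerAl mulrA.
  (* Colinearity of [f] now produces [C m j], which cancels against [E i j = S (C j i)] in the sum
     over [j]. *)
  rewrite /I scaler_suml; apply: eq_bigr => i _.
  under eq_bigr => j _ do rewrite fC mulr_suml.
  rewrite exchange_big /= -(sum_delta (fun m => (f m (h * G l i))%:A) i).
  apply: eq_bigr => m _.
  under eq_bigr => j _ do rewrite -scalerAl.
  rewrite -scaler_sumr (comatrix_antipode_r m i CC) eq_sym -scaler_nat.
  by rewrite scalerA mulrC -scalerA.
(* By the antipode axiom for [E], the sum of [E m l * G l j] over [l] is [(m == j)%:R]. So not all
   [I l] can vanish. *)
have recover m h : \sum_l I l (h * E m l) = f m h.
  rewrite /I exchange_big /= -(@sum_delta _ K^o (fun j => f j h)).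
  apply: eq_bigr => j _; rewrite -(kfun_bigsum _ _ (fL j)).
  under eq_bigr => l _ do rewrite -mulrA.
  have := comatrix_antipode_r m j EC.
  rewrite -mulr_sumr => ->.
  by rewrite mulr_natr -scaler_nat (kfunZ _ _ (fL j)).
have [l /eqP Il] : exists l, I l (h0 * E i0 l) <> 0.
  apply: contrapT => no; move: fh0; rewrite -recover big1 ?eqxx // => l _.
  by apply: contrapT => ne; apply: no; exists l.
by exists (I l); split; [split=> // h; apply: Iint|exists (h0 * E i0 l)].
Qed.

End FromQuotient.

End HopfTheory.

Theorem theorem2p4 (K : fieldType) (H : algType K)
    (D : H -> seq (H * H)) (e : H -> K) (S : H -> H) :
  is_hopf D e S ->
  let i := co_Frobenius D in
  let ii := forall M : comodule D e,
      nonzero_comod M -> has_nonzero_fd_quotient M in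
  let iii := forall M : comodule D e,
      nonzero_comod M -> injective_comod M -> has_nonzero_fd_quotient M in
  let iv := exists M : comodule D e,
      injective_comod M /\ has_nonzero_fd_quotient M in
  [/\ i <-> ii, i <-> iii & i <-> iv].
Proof.
move=> hopfH i ii iii iv.
have i_ii : i -> ii := co_Frobenius_fd_quotient hopfH.
have ii_iii : ii -> iii by move=> h M Mn0 _; apply: h.
have iii_iv : iii -> iv.
  move=> h; exists (regular_comodule hopfH).
  split; [|apply: h]; try exact: regular_injective.
  by exists 1; apply: hopf_one_neq0 hopfH.
have iv_i : iv -> i.
  by move=> [M [Minj MQ]]; exact: (injective_co_Frobenius hopfH Minj MQ).
by split; split=> h; auto.
Qed.
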